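(* Let $0<p<1$, $0<r<1$ and let $K\ge 1$ be an integer. For a network with periodic packet arrivals with period $K$ over the Gilbert-Elliott erasure channel $GE(p,r)$, the average age of information under the preemptive last-generated-first-served (pLGFS) policy is $$\bar\Delta_{pL}=\frac{K+1}{2}+\frac{p}{r(p+r)}.$$
   Context: Time is slotted, $t=1,2,\dots$. Packets are generated (equivalently, arrive at the transmitter) at the beginning of a slot. At most one packet is transmitted per slot; a packet transmitted in slot $t$ and not erased is received at the end of slot $t$, i.e. is available at the receiver at the beginning of slot $t+1$. A packet may be transmitted in the same slot in which it is generated. Channel $GE(p,r)$: the channel state is a two-state Markov chain on $\{G,B\}$ (one step per slot) with transition probability $p$ from $G$ to $B$ and $r$ from $B$ to $G$. A transmission in a slot with state $G$ always succeeds (erasure probability $0$), and in a slot with state $B$ always fails (erasure probability $1$). Periodic arrival with parameter $K$: a new packet arrives exactly at slots $iK+1$, $i=0,1,2,\dots$, and no packet arrives at other slots. pLGFS policy: the transmitter holds a single packet; the latest generated packet is transmitted repeatedly, slot after slot, until it is either successfully delivered or preempted (replaced) by the next arriving packet. Age of information (AoI): at the beginning of slot $t$, $\Delta_t=t-u_t$, where $u_t$ is the generation slot of the latest (most recently generated) packet received by the beginning of slot $t$. The average AoI is the long-run time average $\lim_{\tau\to\infty}\frac1\tau\sum_{t=1}^{\tau}\Delta_t$ (almost surely; the value assigned before the first delivery is irrelevant). *)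

(* Defs.v *)
(* MathComp / MathComp-Analysis *)
From HB Require Import structures.
From mathcomp Require Import all_boot all_order all_algebra.
From mathcomp Require Import all_classical all_reals all_analysis.

Set Implicit Arguments.
Unset Strict Implicit.
Unset Printing Implicit Defensive.

Import Order.TTheory GRing.Theory Num.Theory.
Import numFieldNormedType.Exports.

Local Open Scope classical_set_scope.
Local Open Scope ring_scope.

(* Slots are t = 1, 2, ...; index 0 carries no information. A channel state is
   a boolean: true is the good state G (no erasure), false is the bad state B
   (certain erasure). *)

Definition cond_prob d (T : measurableType d) (R : realType)
    (P : probability T R) (A B : set T) : R :=
  fine (P (A `&` B)) / fine (P B).

Definition GE_transition (R : realType) (p r : R) (i j : bool) : R :=
  match i, j with
  | true, false => p
  | true, true => 1 - p
  | false, true => r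
  | false, false => 1 - r
  end.

Definition history d (T : measurableType d) (R : realType)
    (P : probability T R) (S : nat -> {RV P >-> bool})
    (c : nat -> bool) (t : nat) : set T :=
  [set w | forall k, (1 <= k <= t)%N -> S k w = c k].

(* The law of the initial state S 1 is left arbitrary. *)
Definition GE_channel d (T : measurableType d) (R : realType)
    (P : probability T R) (p r : R) (S : nat -> {RV P >-> bool}) : Prop :=
  forall (c : nat -> bool) (j : bool) (t : nat), (1 <= t)%N ->
    P (history S c t) != 0%E ->
    cond_prob P [set w | S t.+1 w = j] (history S c t)
      = GE_transition p r (c t) j.

(* For t > 0: t = i * K + 1 for some natural number i. *)
Definition arrival (K t : nat) : bool := (0 < t)%N && (K %| t.-1)%N.

(* A packet is identified with its generation slot. [buffer K c t] is the
   packet held at the beginning of slot t, before the possible arrival of that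
   slot, when the channel trajectory is c; [in_service K t b] is the packet
   transmitted in slot t if b is held, an arrival preempting b. *)
Definition in_service (K t : nat) (b : option nat) : option nat :=
  if arrival K t then Some t else b.

Fixpoint buffer (K : nat) (c : nat -> bool) (t : nat) : option nat :=
  if t is s.+1 then
    if c s then None else in_service K s (buffer K c s)
  else None.

Definition delivered (K : nat) (c : nat -> bool) (t : nat) : option nat :=
  if c t then in_service K t (buffer K c t) else None.

(* A packet delivered in slot s is available from the beginning of slot s + 1,
   so those received by the beginning of slot t come from slots 1, ..., t - 1. *)
Definition received (K : nat) (c : nat -> bool) (t : nat) : seq nat :=
  pmap (delivered K c) (iota 1 t.-1).

(* [a0 t] is the value assigned to the age at t before the first delivery. *)
Definition age (R : realType) (K : nat) (c : nat -> bool) (a0 : nat -> R)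
    (t : nat) : R :=
  if received K c t is [::] then a0 t
  else t%:R - (\max_(u <- received K c t) u)%:R.

Definition time_average (R : realType) (x : nat -> R) (tau : nat) : R :=
  tau%:R^-1 * \sum_(1 <= t < tau.+1) x t.

(* Main.v *)
(* Let u be the generation slot of the latest delivered packet at slot t and a
   that of the latest arrival. The age t - u splits into (t - 1) mod K and the
   lag Y_t = a - u. Since the packet in service is always the latest arrival,
   Y_(t+1) = K [K | t] + b_t Y_t, with b_t = 1 when slot t is bad. Replacing b_t
   by its conditional mean given the past turns this recursion into an identity
   (a Poisson equation): the sum of (age - limit) up to n is, up to a bounded
   error, (M_n - Y_(n+1)) / r for a martingale M. Both Y_n and the increments of
   M have bounded second moments, so by Chebyshev and Borel-Cantelli the mean age
   converges almost surely along n = k^4; as ages are nonnegative their sums are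
   monotone, which extends the convergence to all n. All expectations are finite
   sums over words of channel states. *)
Require Import Defs.
From HB Require Import structures.
From mathcomp Require Import all_boot all_order all_algebra.
From mathcomp Require Import all_classical all_reals all_analysis.
From mathcomp Require Import zify ring lra.

Set Implicit Arguments.
Unset Strict Implicit.
Unset Printing Implicit Defensive.

Import Order.TTheory GRing.Theory Num.Theory.
Import numFieldNormedType.Exports.

Local Open Scope classical_set_scope.
Local Open Scope ring_scope.

(** * Residues modulo [K], the lag recursion and its Poisson equation *)

Lemma modnS_cases (K n : nat) : (0 < K)%N ->
  ((n %% K).+1 = K /\ n.+1 %% K = 0)%N \/
  ((n %% K).+1 < K /\ n.+1 %% K = (n %% K).+1)%N.
Proof.
move=> K0; have lt := ltn_pmod n K0.
have -> : (n.+1 %% K = (n %% K).+1 %% K)%N by rewrite -addn1 -modnDml addn1.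
have [e|ne] := eqVneq (n %% K).+1 K; first by left; rewrite e modnn.
have {}lt : ((n %% K).+1 < K)%N by rewrite ltn_neqAle ne.
by right; rewrite (modn_small lt).
Qed.

Section Histories.
Variables (R : realType) (p r : R) (K : nat).

Let lam : R := 1 - r - p.
Let piB : R := p / (p + r).

(* Histories are listed most recent slot first. *)
Fixpoint past (c : nat -> bool) (n : nat) : seq bool :=
  if n is m.+1 then c n :: past c m else [::].

Definition bad (s : bool) : R := (~~ s)%:R.

(* K if slot n + 1 is an arrival slot, and 0 otherwise. *)
Definition jump (n : nat) : R := K%:R * (K %| n)%N%:R.

(* At slot [size v + 1]: the generation slot of the latest arrival minus that
   of the latest delivered packet, as if a packet generated in slot [1 - K] had
   been delivered initially. *)
Fixpoint lag (v : seq bool) : R :=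
  if v is s :: v' then jump (size v) + bad s * lag v' else jump 0.

(** The age at the beginning of slot [size v + 1] under the fictitious initial delivery used in
    [lag]. *)
Definition iage (v : seq bool) : R := (size v %% K)%N%:R + lag v.

(* The K-periodic solution of [weight n - lam * weight n.+1 = jump n.+1]. *)
Definition weight (n : nat) : R :=
  K%:R * lam ^+ (K.-1 - n %% K) / (1 - lam ^+ K).

(** The factor [bad s - p - lam * bad s'] is the innovation of the channel, centred given the past,
    and the other factor depends on the past only. The first slot contributes nothing, since the
    initial law is arbitrary. *)
Fixpoint mart (v : seq bool) : R :=
  if v is s :: v' then
    if v' is s' :: _ then
      mart v' + (bad s - p - lam * bad s') * (lag v' + lam * weight (size v'))
    else 0
  else 0.

(* Solves the Poisson equation [pot_step]; bounded apart from its last two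
   terms. *)
Definition pot (v : seq bool) : R :=
  (size v %% K)%N%:R * ((size v %% K)%N%:R - K%:R) / 2
  + (lam * (1 - piB) * ((size v).-1 %% K)%N%:R - (size v %% K)%N%:R
     - lam * weight (size v).-1 * (bad (head true v) - piB)
     - lag v + mart v) / r.

Definition limit_age : R := (K%:R + 1) / 2 + p / (r * (p + r)).

Hypotheses (p01 : 0 < p < 1) (r01 : 0 < r < 1) (K1 : (1 <= K)%N).

Lemma size_past c n : size (past c n) = n.
Proof. by elim: n => //= n ->. Qed.

Lemma bad_ge0 s : 0 <= bad s. Proof. exact: ler0n. Qed.

Lemma bad_le1 s : bad s <= 1. Proof. by case: s; rewrite /bad /= ?ler01. Qed.

Lemma bad_sqr s : bad s * bad s = bad s.
Proof. by case: s; rewrite /bad /= ?mulr0 ?mulr1. Qed.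

Lemma jump_ge0 n : 0 <= jump n. Proof. by rewrite mulr_ge0 ?ler0n. Qed.

Lemma jump_le n : jump n <= K%:R.
Proof. by rewrite /jump ler_piMr ?ler0n // lern1; case: (_ %| _)%N. Qed.

Lemma jumpS n : jump n.+1 = 1 + (n %% K)%N%:R - (n.+1 %% K)%N%:R.
Proof.
rewrite /jump; have [[e1 e2]|[e1 e2]] := modnS_cases n K1.
  by rewrite /dvdn e2 eqxx mulr1 subr0 -[in LHS]e1 -natr1 addrC.
by rewrite /dvdn e2 mulr0 -natr1 (addrC 1) subrr.
Qed.

Lemma lag_ge0 v : 0 <= lag v.
Proof.
elim: v => [|s v IH] /=; first exact: jump_ge0.
by rewrite addr_ge0 ?mulr_ge0 ?bad_ge0 ?jump_ge0.
Qed.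

Lemma iage_ge0 v : 0 <= iage v.
Proof. by rewrite addr_ge0 ?lag_ge0 ?ler0n. Qed.

Lemma normr_lam_lt1 : `|lam| < 1.
Proof.
case/andP: p01 => ? ?; case/andP: r01 => ? ?.
by rewrite ltr_norml /lam; apply/andP; split; lra.
Qed.

Lemma lamK_lt1 : lam ^+ K < 1.
Proof.
apply: le_lt_trans (ler_norm _) _.
rewrite normrX exprn_ilt1 ?normr_lam_lt1 //; lia.
Qed.

(** [weight n] is the [lam]-discounted sum of the jumps from [n.+1] on; dividing by [1 - lam ^+ K]
    sums the geometric series over the periods. *)
Lemma weight_rec n : weight n - lam * weight n.+1 = jump n.+1.
Proof.
have := lamK_lt1; rewrite -subr_gt0 => /lt0r_neq0 d0.
rewrite /weight /jump /dvdn.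
have [[e1 e2]|[e1 e2]] := modnS_cases n K1; rewrite e2.
  have -> : (K.-1 - n %% K = 0)%N by lia.
  rewrite subn0 eqxx expr0 mulr1.
  have -> : lam ^+ K = lam * lam ^+ K.-1 by rewrite -exprS prednK.
  by move: d0; rewrite -{1}(prednK K1) exprS => d0; field.
have -> : (K.-1 - n %% K = (K.-1 - (n %% K).+1).+1)%N by lia.
by rewrite exprS mulr0; ring.
Qed.

Lemma weight_bound n : `|weight n| <= K%:R / (1 - lam ^+ K).
Proof.
have d0 : 0 < 1 - lam ^+ K by rewrite subr_gt0 lamK_lt1.
rewrite /weight normrM normfV (ger0_norm (ltW d0)) ler_wpM2r ?invr_ge0 ?(ltW d0) //.
rewrite normrM normr_nat ler_piMr ?ler0n // normrX exprn_ile1 //.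
exact: ltW normr_lam_lt1.
Qed.

(** Splitting [bad s] into its innovation and its conditional mean [p + lam * bad s'] gives the lag
    a drift of [- r] times itself, whence the division by [r] in [pot]. The remaining products
    [bad s' * jump] are absorbed by [weight]. *)
Lemma pot_step s s' v : pot (s :: s' :: v) - pot (s' :: v)
  = iage (s' :: v) - limit_age.
Proof.
have := weight_rec (size v); have := jumpS (size v).+1; have := jumpS (size v).
have e : (size v).+1%N = size (s' :: v) by [].
have lg : lag [:: s, s' & v] = jump (size v).+2 + bad s * lag (s' :: v) by [].
(* The lag minus its jump is a multiple of [bad s'], hence fixed by multiplication by this 0-1
   value. *)
have lg' : bad s' * lag (s' :: v) = bad s' * jump (size v).+1 + lag (s' :: v) -
  jump (size v).+1.
  by rewrite /= mulrDr mulrA bad_sqr; ring.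
have mt : mart [:: s, s' & v] = mart (s' :: v) + (bad s - p - lam * bad s') *
   (lag (s' :: v) + lam * weight (size v).+1) by [].
rewrite /pot /iage /limit_age lg mt.
move: lg'; move: (lag (s' :: v)) (mart (s' :: v)) => Y M.
rewrite /= -/lam.
(* The quadratic part of [pot] handles the residue: its increment is the residue minus the mean over
   a period, also at the wrap-around. *)
have phi : ((size v).+2 %% K)%N%:R * (((size v).+2 %% K)%N%:R - K%:R) / 2 -
   ((size v).+1 %% K)%N%:R * (((size v).+1 %% K)%N%:R - K%:R) / 2 =
   ((size v).+1 %% K)%N%:R - (K%:R - 1) / 2 :> R.
  have [[e1 e2]|[e1 e2]] := modnS_cases (size v).+1 K1; rewrite e2.
    have -> : K%:R = ((size v).+1 %% K)%N%:R + 1 :> R by rewrite natr1 e1.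
    by field.
  by rewrite -natr1; field.
move: phi.
set m2 := (_ %% K)%N%:R; set m1 := ((size v).+1 %% K)%N%:R.
set m0 := (size v %% K)%N%:R.
set w0 := weight (size v); set w1 := weight (size v).+1.
move=> phi lg' j1 j2; rewrite j2 => wr.
have [r0 pr0] : r != 0 /\ p + r != 0.
  by case/andP: p01 => ? ?; case/andP: r01 => ? ?; split; apply: lt0r_neq0; lra.
have w0E : w0 = lam * w1 + jump (size v).+1 by rewrite -wr; ring.
rewrite w0E j1.
rewrite j1 in lg'.
have -> : bad s * Y = (bad s - p - lam * bad s') * Y + p * Y + lam * (bad s' * Y).
  by ring.
rewrite lg'.
apply/eqP; rewrite -subr_eq0; apply/eqP.
transitivity ((m2 * (m2 - K%:R) / 2 - m1 * (m1 - K%:R) / 2) - (m1 - (K%:R - 1) / 2)).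
  by rewrite /lam /piB; field; rewrite r0 pr0.
by rewrite phi subrr.
Qed.

(** [r] times the unbounded part of [pot], the only part that calls for probability. *)
Definition dev (v : seq bool) : R := mart v - lag v.

Lemma piB_itv : 0 <= piB <= 1.
Proof.
case/andP: p01 => p0 _; case/andP: r01 => r0 _.
rewrite divr_ge0 ?addr_ge0 ?(ltW p0) ?(ltW r0) //=.
by rewrite ler_pdivrMr ?addr_gt0 // mul1r lerDl ltW.
Qed.

Lemma pot_dev : exists C : R, forall v, `|pot v - dev v / r| <= C.
Proof.
(* In order: the quadratic term, the two residues, and the weight term, where [bad - piB] lies in
   [-1, 1]. *)
exists (K%:R * K%:R + (K%:R + K%:R + K%:R / (1 - lam ^+ K)) / r) => v.
have r0 : 0 < r by case/andP: r01.
have -> : pot v - dev v / r = (size v %% K)%N%:R * ((size v %% K)%N%:R - K%:R) / 2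
  + (lam * (1 - piB) * ((size v).-1 %% K)%N%:R - (size v %% K)%N%:R
     - lam * weight (size v).-1 * (bad (head true v) - piB)) / r.
  by rewrite /pot /dev; ring.
have ml n : (n %% K)%N%:R <= K%:R :> R by rewrite ler_nat ltnW // ltn_pmod.
have lam1 : `|lam| <= 1 by exact: ltW normr_lam_lt1.
case/andP: piB_itv => pi0 pi1.
apply: le_trans (ler_normD _ _) _; apply: lerD.
  have := ml (size v); have : 0 <= (size v %% K)%N%:R :> R by rewrite ler0n.
  move: (_ %% K)%N%:R => x x0 xK.
  rewrite normrM normrM (ger0_norm x0) (ger0_norm (_ : 0 <= 2^-1)) ?invr_ge0 //.
  rewrite distrC ger0_norm ?subr_ge0 //; nra.
rewrite normrM normfV (gtr0_norm r0) ler_wpM2r ?invr_ge0 ?(ltW r0) //.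
apply: le_trans (ler_normB _ _) _; apply: lerD.
  apply: le_trans (ler_normB _ _) _; apply: lerD; last by rewrite normr_nat.
  rewrite -[leRHS]mul1r !normrM normr_nat.
  rewrite ler_pM ?mulr_ge0 ?normr_ge0 ?ler0n //.
  by rewrite -[leRHS]mul1r ler_pM ?normr_ge0 // ger0_norm; lra.
rewrite -[leRHS]mulr1 2!normrM ler_pM ?mulr_ge0 ?normr_ge0 //; last first.
  rewrite ler_norml; have := bad_ge0 (head true v); have := bad_le1 (head true v).
  by move=> ? ?; apply/andP; split; lra.
by rewrite -[leRHS]mul1r ler_pM ?normr_ge0 // weight_bound.
Qed.

(** Telescoping of [pot_step], which starts from a nonempty history; the empty one gives the
    separate term. *)
Lemma sum_iage c n : \sum_(0 <= t < n.+1) (iage (past c t) - limit_age) =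
  iage [::] - limit_age + (pot (past c n.+1) - pot (past c 1)).
Proof.
elim: n => [|n IH]; first by rewrite big_nat1 subrr addr0.
by rewrite big_nat_recr //= IH /= -(pot_step (c n.+2)) /=; ring.
Qed.

Lemma sum_iage_dev : exists C : R, forall c n,
  `|\sum_(0 <= t < n.+1) iage (past c t) - n.+1%:R * limit_age|
    <= C + `|dev (past c n.+1)| / r.
Proof.
have [C HC] := pot_dev.
exists (`|iage [::] - limit_age| + C + (`|pot [:: true]| + `|pot [:: false]|)).
move=> c n.
have -> : \sum_(0 <= t < n.+1) iage (past c t) - n.+1%:R * limit_age =
    \sum_(0 <= t < n.+1) (iage (past c t) - limit_age).
  by rewrite sumrB sumr_const_nat subn0 mulr_natl.
rewrite sum_iage.
have -> : pot (past c n.+1) =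
   (pot (past c n.+1) - dev (past c n.+1) / r) + dev (past c n.+1) / r by ring.
have r0 : 0 < r by case/andP: r01.
have h1 := HC (past c n.+1).
have h2 : `|pot (past c 1)| <= `|pot [:: true]| + `|pot [:: false]|.
  by rewrite /=; case: (c 1%N); rewrite ?lerDl ?lerDr normr_ge0.
have h3 : `|dev (past c n.+1) / r| = `|dev (past c n.+1)| / r.
  by rewrite normrM normfV (gtr0_norm r0).
apply: le_trans (ler_normD _ _) _.
set P := _ + dev _ / r.
have := ler_normB P (pot (past c 1)).
have := ler_normD (pot (past c n.+1) - dev (past c n.+1) / r) (dev (past c n.+1) / r).
by rewrite h3 -/P; lra.
Qed.

End Histories.

(** * Second moments under a Markov weighting of words *)

Fixpoint words (n : nat) : seq (seq bool) :=
  if n is m.+1 then map (cons true) (words m) ++ map (cons false) (words m)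
  else [:: [::]].

Lemma mem_words n v : (v \in words n) = (size v == n).
Proof.
elim: n v => [|n IH] [|s v] //=; rewrite mem_cat.
  by apply/negbTE/norP; split; apply/mapP => -[].
have inj (b : bool) : injective (cons b) by move=> x y [].
have disj b : (b :: v \in map (cons (~~ b)) (words n)) = false.
  by apply/negbTE/mapP => -[? _ []]; case: b.
by case: s; rewrite (mem_map (@inj _)) IH ?(disj true) ?(disj false) ?orbF eqSS.
Qed.

Lemma big_words (R : realType) n (F : seq bool -> R) :
  \sum_(v <- words n.+1) F v =
  \sum_(v <- words n) (F (true :: v) + F (false :: v)).
Proof. by rewrite /= big_cat !big_map /= big_split. Qed.

Section SecondMoments.
Variables (R : realType) (p r : R) (K : nat) (mu : seq bool -> R).

Hypotheses (p01 : 0 < p < 1) (r01 : 0 < r < 1) (K1 : (1 <= K)%N).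
(** [mu] stands for the law of the histories. The Markov rule starts at the second slot, which
    leaves the initial law free. *)
Hypothesis mu_ge0 : forall v, 0 <= mu v.
Hypothesis mu0 : mu [::] = 1.
Hypothesis mu_split : forall v, mu (true :: v) + mu (false :: v) = mu v.
Hypothesis mu_step : forall j s v,
  mu (j :: s :: v) = GE_transition p r s j * mu (s :: v).

Definition expect (n : nat) (F : seq bool -> R) : R :=
  \sum_(v <- words n) mu v * F v.

Lemma expect_cst n a : expect n (fun=> a) = a.
Proof.
rewrite /expect -mulr_suml.
suff -> : \sum_(v <- words n) mu v = 1 by rewrite mul1r.
elim: n => [|n IH]; first by rewrite big_seq1.
by rewrite big_words; under eq_bigr do rewrite mu_split.
Qed.

Lemma expect_affine n a b F G :
  expect n (fun v => a * F v + b * G v) = a * expect n F + b * expect n G.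
Proof.
rewrite /expect !mulr_sumr -big_split; apply: eq_bigr => v _ /=; ring.
Qed.

Lemma le_expect n F G : (forall v, size v = n -> F v <= G v) ->
  expect n F <= expect n G.
Proof.
move=> FG; rewrite /expect big_seq [leRHS]big_seq; apply: ler_sum => v.
by rewrite mem_words => /eqP /FG ?; rewrite ler_wpM2l.
Qed.

(** Tower property as an inequality: [G] dominates the conditional mean of [F] given the past. *)
Lemma expect_step n F G :
  (forall s v, GE_transition p r s true * F [:: true, s & v] +
     GE_transition p r s false * F [:: false, s & v] <= G (s :: v)) ->
  expect n.+2 F <= expect n.+1 G.
Proof.
move=> FG; rewrite /expect big_words big_seq [leRHS]big_seq.
apply: ler_sum => -[|s v]; rewrite mem_words // => _.
rewrite !mu_step; have := FG s v; have := mu_ge0 (s :: v); nra.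
Qed.

(** This is the conditional mean subtracted in [mart]; its slope is the second eigenvalue of the
    transition matrix. *)
Lemma GE_transition_false s :
  GE_transition p r s false = p + (1 - r - p) * bad R s.
Proof. by case: s; rewrite /bad /=; ring. Qed.

(** A drift argument: a good slot resets the lag to at most [K], so the squared lag contracts in
    conditional mean, up to a constant. *)
Lemma expect_lag : exists2 B : R, 0 <= B &
  forall n, expect n.+1 (fun v => lag R K v ^+ 2) <= B.
Proof.
(* [q] bounds the chance of a bad slot from either state. *)
have [q [q1 pq rq]] : exists q : R, [/\ 0 <= q < 1, p <= q & 1 - r <= q].
  exists (Num.max p (1 - r)); rewrite le_max gt_max !le_max !lexx orbT.
  by case/andP: p01 => ? ?; case/andP: r01 => ? ?; split=> //; apply/andP; split; lra.
case/andP: q1 => q0 q1.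
have k0 : 0 <= K%:R :> R by rewrite ler0n.
have d0 : 0 < 1 - q by rewrite subr_gt0.
pose b : R := K%:R ^+ 2 + 2 * K%:R ^+ 2 / (1 - q).
have b0 : 0 <= b.
  by rewrite addr_ge0 ?sqr_ge0 // divr_ge0 ?(ltW d0) // mulr_ge0 ?sqr_ge0.
(* The first term covers the lag after one slot, at most [2 * K]; the second is the fixed point of
   [x -> (1 + q) / 2 * x + b]. *)
pose B := 4 * K%:R ^+ 2 + b * 2 / (1 - q).
have B0 : 0 <= b * 2 / (1 - q) by rewrite divr_ge0 ?(ltW d0) // mulr_ge0.
exists B; first by rewrite /B addr_ge0 // mulr_ge0 ?sqr_ge0.
elim=> [|n IH].
  rewrite -(expect_cst 1 B); apply: le_expect => -[|s [|]] //= _.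
  rewrite /B; apply: ler_wpDr => //.
  have -> : 4 * K%:R ^+ 2 = (K%:R + K%:R) ^+ 2 :> R by ring.
  have h0 := jump_ge0 R K 0; have h1 := jump_ge0 R K 1.
  have h2 := bad_ge0 R s; have h3 := bad_le1 R s.
  have h4 := jump_le R K 0; have h5 := jump_le R K 1.
  by rewrite ler_sqr ?nnegrE ?addr_ge0 ?mulr_ge0 // lerD // -[leRHS]mul1r ler_pM.
have step : expect n.+2 (fun v => lag R K v ^+ 2) <=
    expect n.+1 (fun v => (1 + q) / 2 * lag R K v ^+ 2 + b * 1).
  apply: expect_step => s v; rewrite mulr1.
  have := lag_ge0 R K (s :: v).
  have -> : lag R K [:: true, s & v] = jump R K (size v).+2.
    by rewrite /= mul0r addr0.
  have -> : lag R K [:: false, s & v] = jump R K (size v).+2 + lag R K (s :: v).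
    by rewrite /= mul1r.
  have := jump_le R K (size v).+2; have := jump_ge0 R K (size v).+2.
  move: (lag _ _ _) (jump _ _ _) => Y k kp kK Y0.
  have -> : GE_transition p r s true = 1 - GE_transition p r s false.
    by case: s => /=; ring.
  have [e0 eq] : 0 <= GE_transition p r s false /\ GE_transition p r s false <= q.
    by case/andP: p01 => ? ?; case/andP: r01 => ? ?; case: s => /=; lra.
  move: (GE_transition _ _ _ _) e0 eq => e e0 eq.
  have h1 : e * k * Y <= K%:R * Y by rewrite ler_wpM2r //; nra.
  have h2 : e * Y ^+ 2 <= q * Y ^+ 2 by rewrite ler_wpM2r ?sqr_ge0.
  have h3 : k ^+ 2 <= K%:R ^+ 2 by rewrite ler_sqr ?nnegrE.
  (* Completing the square trades the cross term [2 * K * Y] for half of the gap [1 - q]; the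
     leftover constant enters [b]. *)
  have h4 : 0 <= (1 - q) / 2 * (Y - 2 * K%:R / (1 - q)) ^+ 2.
    by rewrite mulr_ge0 ?sqr_ge0 // divr_ge0 // ltW.
  have h5 : (1 - q) / 2 * (Y - 2 * K%:R / (1 - q)) ^+ 2 =
     (1 - q) / 2 * Y ^+ 2 - 2 * K%:R * Y + 2 * K%:R ^+ 2 / (1 - q).
    by field; rewrite lt0r_neq0.
  rewrite h5 in h4; rewrite /b; nra.
apply: le_trans step _; rewrite expect_affine expect_cst.
have h : (1 + q) / 2 * B + b <= B.
  have -> : b = (1 - q) / 2 * (b * 2 / (1 - q)) by field; rewrite lt0r_neq0.
  have : 0 <= K%:R ^+ 2 :> R by rewrite sqr_ge0.
  rewrite /B; nra.
apply: le_trans h; rewrite mulr1 lerD2r ler_wpM2l // divr_ge0 //; lra.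
Qed.

(** Orthogonality of increments: the cross term has conditional mean zero, and each squared
    increment adds the Bernoulli variance [e * (1 - e)] times a factor with bounded mean. *)
Lemma expect_mart : exists2 C : R, 0 <= C &
  forall n, expect n.+1 (fun v => mart p r K v ^+ 2) <= C * n%:R.
Proof.
have [B B0 HB] := expect_lag.
pose G : R := K%:R / (1 - (1 - r - p) ^+ K).
exists (2 * B + 2 * G ^+ 2).
  by apply: addr_ge0; apply: mulr_ge0 => //; exact: sqr_ge0.
elim=> [|n IH].
  rewrite mulr0 -(expect_cst 1 0); apply: le_expect => -[|s [|]] //= _.
  by rewrite expr0n.
have step : expect n.+2 (fun v => mart p r K v ^+ 2) <= expect n.+1 (fun v =>
    1 * mart p r K v ^+ 2 + 1 * (2 * lag R K v ^+ 2 + 2 * G ^+ 2)).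
  apply: expect_step => s v.
  have -> : GE_transition p r s true = 1 - GE_transition p r s false.
    by case: s => /=; ring.
  have mE j : mart p r K [:: j, s & v] = mart p r K (s :: v) +
      (bad R j - GE_transition p r s false) *
      (lag R K (s :: v) + (1 - r - p) * weight p r K (size (s :: v))).
    by rewrite GE_transition_false /=; ring.
  rewrite !mE; clear mE.
  have wG : ((1 - r - p) * weight p r K (size (s :: v))) ^+ 2 <= G ^+ 2.
    rewrite -real_normK ?num_real // ler_sqr ?nnegrE ?normr_ge0 //; last first.
      by apply: le_trans (normr_ge0 _) (weight_bound p01 r01 K1 0).
    rewrite normrM -[leRHS]mul1r ler_pM ?normr_ge0 ?(weight_bound p01 r01 K1) //.
    exact: ltW (normr_lam_lt1 p01 r01).
  move: (_ * weight _ _ _ _) wG (mart _ _ _ _) (lag _ _ _) => w wG M Y.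
  have [e0 e1] : 0 <= GE_transition p r s false /\ GE_transition p r s false <= 1.
    by case/andP: p01 => ? ?; case/andP: r01 => ? ?; case: s => /=; lra.
  move: (GE_transition _ _ _ _) e0 e1 => e e0 e1.
  have -> : (1 - e) * (M + (bad R true - e) * (Y + w)) ^+ 2 +
     e * (M + (bad R false - e) * (Y + w)) ^+ 2 =
     M ^+ 2 + e * (1 - e) * (Y + w) ^+ 2 by rewrite /bad /=; ring.
  rewrite !mul1r lerD2l; apply: (@le_trans _ _ (1 * (Y + w) ^+ 2)).
    by rewrite ler_wpM2r ?sqr_ge0 //; nra.
  have := sqr_ge0 (Y - w); nra.
apply: le_trans step _; rewrite expect_affine !mul1r.
have -> : expect n.+1 (fun v => 2 * lag R K v ^+ 2 + 2 * G ^+ 2) =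
    2 * expect n.+1 (fun v => lag R K v ^+ 2) + 2 * expect n.+1 (fun=> G ^+ 2).
  by rewrite expect_affine.
rewrite expect_cst -[n.+1%:R]natr1 mulrDr mulr1 lerD // lerD2r ler_wpM2l //.
Qed.

Lemma expect_dev : exists2 C : R, 0 <= C &
  forall n, expect n.+1 (fun v => dev p r K v ^+ 2) <= C * n.+1%:R.
Proof.
have [B B0 HB] := expect_lag; have [C C0 HC] := expect_mart.
exists (2 * C + 2 * B); first by rewrite addr_ge0 ?mulr_ge0.
move=> n.
apply: (@le_trans _ _ (expect n.+1 (fun v => 2 * mart p r K v ^+ 2 + 2 * lag R K v ^+ 2))).
  apply: le_expect => v _; rewrite /dev.
  have := sqr_ge0 (mart p r K v + lag R K v); nra.
rewrite expect_affine -[n.+1%:R]natr1.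
have := HB n; have := HC n; have : 0 <= n%:R :> R by rewrite ler0n.
have : 0 <= B * n%:R by rewrite mulr_ge0 ?ler0n.
nra.
Qed.

(** With [k ^ 4] slots and [a = k ^ 3] the bound is of order [k ^ -2], hence summable. *)
Lemma dev_chebyshev : exists2 C : R, 0 <= C & forall n a, 0 < a ->
  \sum_(v <- words n.+1 | a <= `|dev p r K v|) mu v <= C * n.+1%:R / a ^+ 2.
Proof.
have [C C0 HC] := expect_dev; exists C => // n a a0.
rewrite ler_pdivlMr ?exprn_gt0 //; apply: le_trans (HC n).
rewrite mulr_suml /expect big_mkcond /=; apply: ler_sum => v _.
case: ifP => [av|_]; last by rewrite mulr_ge0 ?sqr_ge0.
rewrite ler_wpM2l // -(real_normK (num_real (dev _ _ _ _))).
by rewrite ler_sqr ?nnegrE ?normr_ge0 ?(ltW a0).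
Qed.

End SecondMoments.

(** * The law of the channel histories *)

Lemma past_eqP c c' n :
  past c n = past c' n <-> forall k, (1 <= k <= n)%N -> c k = c' k.
Proof.
elim: n => [|n IH]; first by split=> // _ k; lia.
split=> /= [[e /IH h] k kn|h].
  by have [->//|kn'] := eqVneq k n.+1; apply: h; lia.
by rewrite h ?leqnn // (IH.2 _) // => k kn; apply: h; lia.
Qed.

(** Links words to the trajectories by which [history] is indexed. *)
Lemma past_surj v : exists c, past c (size v) = v.
Proof.
elim: v => [|s v [c cv]]; first by exists xpredT.
exists (fun k => if k == (size v).+1 then s else c k) => /=; rewrite eqxx.
congr (_ :: _); rewrite -[RHS]cv; apply/past_eqP => k kv.
by case: eqVneq => //; lia.
Qed.

Section PathLaw.
Context (R : realType) (d : measure_display) (T : measurableType d).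
Context (P : probability T R) (p r : R) (S : nat -> {RV P >-> bool}).
Hypothesis HGE : GE_channel p r S.

Definition cylinder (v : seq bool) : set T :=
  [set w | past (fun t => S t w) (size v) = v].

Definition law (v : seq bool) : R := fine (P (cylinder v)).

Lemma measurable_state n b : measurable [set w | S n w = b].
Proof.
rewrite -[X in measurable X]setTI.
exact: (@measurable_funPT _ _ _ _ (S n) measurableT [set b]).
Qed.

Lemma cylinder_cons b v :
  cylinder (b :: v) = [set w | S (size v).+1 w = b] `&` cylinder v.
Proof. by apply/seteqP; split => w; rewrite /cylinder /= => -[-> ->]. Qed.

Lemma measurable_cylinder v : measurable (cylinder v).
Proof.
elim: v => [|b v IH].
  rewrite (_ : cylinder [::] = setT); first exact: measurableT.
  by apply/seteqP.
by rewrite cylinder_cons; apply: measurableI => //; exact: measurable_state.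
Qed.

Lemma law_ge0 v : 0 <= law v.
Proof. by rewrite fine_ge0. Qed.

Lemma lawE v : P (cylinder v) = (law v)%:E.
Proof. by rewrite fineK // fin_num_measure //; exact: measurable_cylinder. Qed.

Lemma law_nil : law [::] = 1.
Proof.
rewrite /law (_ : cylinder [::] = setT) ?probability_setT //.
by apply/seteqP.
Qed.

Lemma law_split v : law (true :: v) + law (false :: v) = law v.
Proof.
apply: EFin_inj; rewrite EFinD -!lawE -measureU.
- congr (P _); rewrite !cylinder_cons -setIUl.
  apply/seteqP; split => w /=; first by case.
  by move=> h; split=> //; case: (S _ w); [left|right].
- exact: measurable_cylinder.
- exact: measurable_cylinder.
- apply/seteqP; split => w //; rewrite !cylinder_cons.
  by move=> [[/= -> _] []].
Qed.

Lemma law_step j s v : law (j :: s :: v) = GE_transition p r s j * law (s :: v).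
Proof.
have [c cv] := past_surj (s :: v).
have hE : history S c (size v).+1 = cylinder (s :: v).
  apply/seteqP; split => w.
    by move=> h; apply: (etrans _ cv); apply/past_eqP.
  by move=> h; have /past_eqP := etrans h (esym cv).
have cs : c (size v).+1 = s by move: cv => [].
(* [GE_channel] is silent on null histories; there the laws of both extensions are nonnegative with
   sum zero. *)
have [P0|P0] := eqVneq (P (cylinder (s :: v))) 0%E.
  have l0 : law (s :: v) = 0 by rewrite /law P0.
  have := law_split (s :: v); have := law_ge0 (true :: s :: v).
  have := law_ge0 (false :: s :: v); rewrite l0 mulr0.
  by case: j; lra.
have := @HGE c j (size v).+1 isT; rewrite hE cs => /(_ P0) <-.
rewrite /cond_prob /law cylinder_cons divfK //.
by apply: contra P0 => /eqP h; rewrite lawE /law h.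
Qed.

Lemma measurable_past_mem n (s : seq (seq bool)) :
  measurable [set w | past (fun t => S t w) n \in s].
Proof.
elim: s => [|v s IH].
  by rewrite (_ : [set _ | _] = set0) //; apply/seteqP; split.
rewrite (_ : [set _ | _] = [set w | past (S ^~ w) n = v] `|`
   [set w | past (S ^~ w) n \in s]); last first.
  apply/seteqP; split => w /=; rewrite inE.
    by move=> /orP[/eqP|]; [left|right].
  by move=> [->|->]; rewrite ?eqxx ?orbT.
apply: measurableU => //; have [vn|vn] := eqVneq (size v) n.
  by rewrite -vn; exact: measurable_cylinder.
rewrite (_ : [set _ | _] = set0) //; apply/seteqP; split => w //= e.
by move: vn; rewrite -e size_past eqxx.
Qed.

(** There are finitely many words of length [n], so any event on the past is a finite union of
    cylinders. *)
Lemma past_filterE n (Q : pred (seq bool)) :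
  [set w | Q (past (S ^~ w) n)] =
  [set w | past (S ^~ w) n \in [seq v <- words n | Q v]].
Proof.
apply/seteqP; split => w /=;
  by rewrite mem_filter mem_words size_past eqxx andbT.
Qed.

Lemma measurable_past n (Q : pred (seq bool)) :
  measurable [set w | Q (past (S ^~ w) n)].
Proof. by rewrite past_filterE; exact: measurable_past_mem. Qed.

Lemma prob_past_le n (Q : pred (seq bool)) :
  (P [set w | Q (past (S ^~ w) n)] <= (\sum_(v <- words n | Q v) law v)%:E)%E.
Proof.
rewrite past_filterE -big_filter.
have : all (fun v => size v == n) [seq v <- words n | Q v].
  by apply/allP => v; rewrite mem_filter mem_words => /andP[].
elim: [seq v <- words n | Q v] => [_|v s IH /= /andP[/eqP vn sn]].
  rewrite big_nil (_ : [set _ | _] = set0) ?measure0 //.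
  by apply/seteqP; split.
rewrite big_cons EFinD -lawE.
apply: le_trans (leeD2l _ (IH sn)).
rewrite (_ : [set _ | _] = cylinder v `|` [set w | past (S ^~ w) n \in s]).
  apply: measureU2; [exact: measurable_cylinder|exact: measurable_past_mem].
apply/seteqP; split => w /=; rewrite /cylinder /= inE vn.
  by move=> /orP[/eqP|]; [left|right].
by move=> [->|->]; rewrite ?eqxx ?orbT.
Qed.

End PathLaw.

(** * From the idealized age to the age of the policy *)

(** The jump of the lag cancels the drop of the residue, so arrivals need no case distinction. *)
Lemma iage_cons (R : realType) (K : nat) s v : (1 <= K)%N ->
  iage R K (s :: v) = 1 + if s then (size v %% K)%N%:R else iage R K v.
Proof.
by move=> K1; rewrite /iage /= (jumpS _ K1); case: s; rewrite /bad /=; ring.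
Qed.

Lemma received_step K c n : received K c n.+2 =
  received K c n.+1 ++ seq_of_opt (delivered K c n.+1).
Proof.
rewrite /received -[n.+2.-1]/(n.+1) -[n.+1 in LHS]addn1 iotaD pmap_cat add1n.
by congr (_ ++ _); rewrite /=; case: delivered.
Qed.

(* While no packet has been delivered since the last arrival, the packet in
   service is that arrival; afterwards there is none. *)
Lemma received_invariant (R : realType) K c n : (1 <= K)%N ->
  let rcv := received K c n.+1 in
  let latest := (n.+1 - n %% K)%N in
  let held := in_service K n.+1 (buffer K c n.+1) in
  [/\ (\max_(u <- rcv) u <= latest)%N,
      held = Some latest \/
        [/\ held = None, rcv != [::] & \max_(u <- rcv) u = latest],
      rcv != [::] -> n.+1%:R - (\max_(u <- rcv) u)%:R = iage R K (past c n)
    & forall k, (1 <= k <= n)%N -> c k -> rcv != [::]].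
Proof.
move=> K1; elim: n => [|n [IH1 IH2 IH3 IH4]] rcv latest held.
  rewrite /rcv /received /= big_nil; split=> // [|k]; last by lia.
  by left; rewrite /held /in_service /arrival dvdn0 /latest mod0n.
have nK : (n %% K <= n)%N by exact: leq_mod.
have heldE : held = if (K %| n.+1)%N then Some n.+2 else
    if c n.+1 then None else in_service K n.+1 (buffer K c n.+1).
  by rewrite /held /in_service /arrival.
have latestE : latest = if (K %| n.+1)%N then n.+2 else (n.+1 - n %% K)%N.
  rewrite /latest /dvdn; have [[_ ->]|[_ ->]] := modnS_cases n K1.
    by rewrite eqxx subn0.
  by rewrite subSS.
have le_latest : (n.+1 - n %% K <= latest)%N.
  by rewrite latestE; case: ifP => // _; lia.
have rcvE : rcv = received K c n.+1 ++ seq_of_opt (delivered K c n.+1).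
  exact: received_step.
rewrite heldE rcvE big_cat /= iage_cons // size_past /delivered.
case: ifPn => cn.
  have [rcv0 maxE] :
      (received K c n.+1 ++ seq_of_opt (in_service K n.+1 (buffer K c n.+1)) != [::])
      /\ (maxn (\max_(u <- received K c n.+1) u)
         (\max_(u <- seq_of_opt (in_service K n.+1 (buffer K c n.+1))) u) =
        n.+1 - n %% K)%N.
    (* Either the latest arrival is held and gets delivered now, or it was delivered earlier and
       nothing is sent. *)
    case: IH2 => [->|[-> rcv0 ->]] /=.
      by rewrite big_seq1 (maxn_idPr IH1); split=> //; case: (received _ _ _).
    by rewrite big_nil maxn0 cats0.
  rewrite maxE; split=> //.
  - by rewrite latestE; case: ifP => _; [left|right].
  - move=> _; rewrite natrB; last by lia.
    by rewrite -[n.+2%:R]natr1; ring.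
rewrite big_nil maxn0 cats0; split.
- exact: leq_trans le_latest.
- by rewrite latestE; case: ifP => _; [left|exact: IH2].
- by move=> /IH3 <-; rewrite -[n.+2%:R]natr1; ring.
- move=> k kn ck; apply: (IH4 k) => //.
  by have [kE|kn'] := eqVneq k n.+1; [rewrite kE (negbTE cn) in ck|lia].
Qed.

(** The first good slot always finds a packet in service, so from then on [a0] is not consulted and
    the fictitious packet is superseded. *)
Lemma age_iage (R : realType) K (c : nat -> bool) (a0 : nat -> R) n k :
  (1 <= K)%N -> (1 <= k <= n)%N -> c k ->
  age K c a0 n.+1 = iage R K (past c n).
Proof.
move=> K1 kn ck; have [_ _ h3 h4] := received_invariant R c n K1.
have := h3 (h4 _ kn ck); have := h4 _ kn ck; rewrite /age.
by case: (received K c n.+1).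
Qed.

Lemma iage_all_bad (R : realType) K c n : (1 <= K)%N ->
  (forall k, (1 <= k <= n)%N -> c k = false) -> n%:R <= iage R K (past c n).
Proof.
move=> K1; elim: n => [|n IH] h; first exact: iage_ge0.
rewrite [past c n.+1]/= iage_cons // h ?leqnn // -[n.+1%:R]natr1 addrC lerD2l.
by apply: IH => k kn; apply: h; lia.
Qed.

(** * Convergence of means *)

Lemma exists_fourth_root n : (0 < n)%N ->
  exists j, [/\ (0 < j)%N, (j ^ 4 <= n)%N & (n < j.+1 ^ 4)%N].
Proof.
elim: n => // -[_ _|n /(_ isT) [j [j0 jn nj]] _]; first by exists 1%N.
have [e|ne] := eqVneq n.+2 (j.+1 ^ 4)%N; last by exists j; split; lia.
by exists j.+1; split; rewrite ?e // ltn_exp2r.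
Qed.

(** Partial sums are monotone, so those between two consecutive fourth powers are sandwiched; the
    gap is of order [j ^ 3], negligible against [j ^ 4]. *)
Lemma mean_cvg_of_fourth_powers (R : realType) (x : nat -> R) (L D : R) k0 :
  (forall t, 0 <= x t) ->
  (forall k, (k0 <= k)%N ->
    `|\sum_(0 <= t < k ^ 4) x t - (k ^ 4)%N%:R * L| <= D * k%:R ^+ 3) ->
  arithmetic_mean x @ \oo --> L.
Proof.
move=> x0 HD.
have bound j n : (0 < j)%N -> (k0 <= j)%N -> (j ^ 4 <= n.+1)%N ->
    (n.+1 < j.+1 ^ 4)%N ->
    (* For [y >= 1], [(y + 1) ^ 4 - y ^ 4] is at most [(4 + 6 + 4 + 1) * y ^ 3], and [(y + 1) ^ 3]
       is at most [(2 * y) ^ 3]. *)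
    `|L - arithmetic_mean x n| <= (15 * `|L| + 8 * `|D|) / j%:R.
  move=> j0 kj jn nj.
  have mono a b : (a <= b)%N ->
      \sum_(0 <= t < a) x t <= \sum_(0 <= t < b) x t.
    by move=> ab; rewrite (big_cat_nat _ ab) //= lerDl sumr_ge0.
  rewrite /arithmetic_mean /series /=.
  have h5 := mono _ _ (ltnW nj); have h6 := mono _ _ jn.
  have := HD _ (leqW kj); rewrite ler_distl natrX => /andP[h3 h4].
  have := HD _ kj; rewrite ler_distl natrX => /andP[h1 h2].
  move: (\sum_(0 <= t < n.+1) x t) h5 h6 => s h5 h6.
  have n0 : 0 < n.+1%:R :> R by rewrite ltr0n.
  have jn' : j%:R ^+ 4 <= n.+1%:R :> R by rewrite -natrX ler_nat.
  have nj' : n.+1%:R <= j.+1%:R ^+ 4 :> R by rewrite -natrX ler_nat ltnW.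
  have j1 : 1 <= j%:R :> R by rewrite ler1n.
  rewrite -[j.+1%:R]natr1 in h3 h4 nj'.
  move: n.+1%:R n0 j%:R j1 jn' nj' h1 h2 h3 h4 => N N0 y y1 yN Ny h1 h2 h3 h4.
  have y3 : 1 <= y ^+ 3 by rewrite exprn_ege1 //.
  have yy3 : y <= y ^+ 3 by rewrite -[leLHS]expr1 ler_weXn2l.
  have yy2 : y ^+ 2 <= y ^+ 3 by rewrite ler_weXn2l.
  have e4 : (y + 1) ^+ 4 <= y ^+ 4 + 15 * y ^+ 3.
    have -> : (y + 1) ^+ 4 = y ^+ 4 + 4 * y ^+ 3 + 6 * y ^+ 2 + 4 * y + 1 by ring.
    lra.
  have e3 : (y + 1) ^+ 3 <= 8 * y ^+ 3.
    have -> : (y + 1) ^+ 3 = y ^+ 3 + 3 * y ^+ 2 + 3 * y + 1 by ring.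
    lra.
  have D3 : D * (y + 1) ^+ 3 <= `|D| * (8 * y ^+ 3).
    apply: (@le_trans _ _ (`|D| * (y + 1) ^+ 3)); last by rewrite ler_wpM2l.
    by rewrite ler_wpM2r ?ler_norm // exprn_ge0 //; lra.
  have D3' : D * y ^+ 3 <= `|D| * (8 * y ^+ 3).
    apply: (@le_trans _ _ (`|D| * y ^+ 3)); last by rewrite ler_wpM2l //; lra.
    by rewrite ler_wpM2r ?ler_norm //; lra.
  have gap z : y ^+ 4 <= z <= (y + 1) ^+ 4 ->
      `|(z - N) * L| <= 15 * y ^+ 3 * `|L|.
    move=> /andP[z1 z2]; rewrite normrM ler_wpM2r // ler_norml.
    by apply/andP; split; lra.
  have g1 : `|(y ^+ 4 - N) * L| <= 15 * y ^+ 3 * `|L|.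
    by apply: gap; rewrite lexx /=; lra.
  have g2 : `|((y + 1) ^+ 4 - N) * L| <= 15 * y ^+ 3 * `|L|.
    by apply: gap; rewrite lexx andbT; lra.
  have main : `|N * L - s| <= (15 * `|L| + 8 * `|D|) * y ^+ 3.
    move: g1 g2; rewrite !ler_norml => /andP[? ?] /andP[? ?].
    by apply/andP; split; lra.
  have -> : L - N^-1 * s = (N * L - s) / N by field; rewrite lt0r_neq0.
  rewrite normrM normfV (gtr0_norm N0) ler_pdivrMr //.
  apply: le_trans main _; rewrite -mulrA ler_wpM2l ?addr_ge0 ?mulr_ge0 //.
  by rewrite [leRHS]mulrC ler_pdivlMr -?exprSr //; lra.
apply/cvgrPdist_le => eps eps0.
pose A := 15 * `|L| + 8 * `|D|.
have A0 : 0 <= A by rewrite addr_ge0 ?mulr_ge0.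
pose m := maxn (Num.truncn (A / eps)).+1 k0.
near=> n.
have [j [j0 jn nj]] := @exists_fourth_root n.+1 isT.
have mj : (m <= j)%N.
  rewrite -ltnS -(@ltn_exp2r _ _ 4) //; apply: leq_ltn_trans nj.
  by apply: leqW; near: n; exact: nbhs_infty_ge.
have [mj1 mj2] : ((Num.truncn (A / eps)).+1 <= j)%N /\ (k0 <= j)%N.
  by move: mj; rewrite geq_max => /andP[].
apply: le_trans (bound j n _ _ _ _) _ => //.
rewrite ler_pdivrMr ?ltr0n // -ler_pdivrMl // [leLHS]mulrC.
have Ae : A / eps < (Num.truncn (A / eps)).+1%:R.
  by have /andP[] := truncn_itv (divr_ge0 A0 (ltW eps0)).
by apply: ltW; apply: lt_le_trans Ae _; rewrite ler_nat.
Unshelve. all: by end_near.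
Qed.

Lemma arithmetic_mean_unbounded (R : realType) (x : nat -> R) (L : R) :
  (forall n, n%:R <= x n) -> ~ arithmetic_mean x @ \oo --> L.
Proof.
move=> nx /cvgrPdist_le /(_ _ ltr01) [N _ HN].
(* The mean at index [n] is at least [n / 2], which this choice puts above [L + 1]. *)
pose n := maxn N (Num.truncn (2 * `|L| + 2)).+1.
have := HN n (leq_maxl _ _); rewrite /arithmetic_mean /series /=.
have hn : 2 * `|L| + 2 < n%:R.
  have /truncn_itv /andP[_ h] : 0 <= 2 * `|L| + 2 by rewrite addr_ge0 ?mulr_ge0.
  by apply: lt_le_trans h _; rewrite ler_nat leq_maxr.
have hs m : m%:R * (m%:R - 1) / 2 <= \sum_(0 <= k < m) x k.
  elim: m => [|m IH]; first by rewrite big_nil; lra.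
  rewrite big_nat_recr //= -[m.+1%:R]natr1; have := nx m.
  by move: (m%:R) IH => y; lra.
have := hs n.+1; have n0 : 0 < n.+1%:R :> R by rewrite ltr0n.
move: (\sum_(0 <= k < n.+1) x k) => s hs'.
rewrite ler_norml => /andP[h _].
have : n.+1%:R^-1 * (n.+1%:R * (n.+1%:R - 1) / 2) <= n.+1%:R^-1 * s.
  by rewrite ler_wpM2l ?invr_ge0 ?(ltW n0).
rewrite -mulrA mulKf ?lt0r_neq0 // -[n.+1%:R]natr1 in h *.
by have := ler_norm L; lra.
Qed.

Lemma time_average_shift (R : realType) (y : nat -> R) n :
  time_average y n.+1 = arithmetic_mean (fun t => y t.+1) n.
Proof. by rewrite /time_average /arithmetic_mean /series /= big_add1. Qed.

(** The difference of the sequences is eventually zero, so its Cesaro means vanish. *)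
Lemma time_average_cvg (R : realType) (x y : nat -> R) (L : R) k0 :
  (forall t, (k0 <= t)%N -> y t.+1 = x t) ->
  arithmetic_mean x @ \oo --> L -> time_average y tau @[tau --> \oo] --> L.
Proof.
move=> yx xL; rewrite -cvg_shiftS.
have -> : [sequence time_average y n.+1]_n =
    (fun n => arithmetic_mean x n + arithmetic_mean (fun t => y t.+1 - x t) n).
  apply/funext => n /=; rewrite time_average_shift /arithmetic_mean /series /=.
  by rewrite -mulrDr -big_split /=; congr (_ * _); apply: eq_bigr => i _; ring.
rewrite -[L]addr0; apply: cvgD => //; apply: cesaro.
apply: (@cvg_trans _ ((fun=> 0 : R) @ \oo)); last exact: cvg_cst.
apply: near_eq_cvg; near=> t; rewrite yx ?subrr //.
near: t; exact: nbhs_infty_ge.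
Unshelve. all: by end_near.
Qed.

(** * Almost sure control by Borel-Cantelli, and conclusion *)

Lemma ae_dev_small (R : realType) (d : measure_display) (T : measurableType d)
    (P : probability T R) (p r : R) (K : nat) (S : nat -> {RV P >-> bool}) :
  0 < p < 1 -> 0 < r < 1 -> (1 <= K)%N -> GE_channel p r S ->
  {ae P, forall w, exists k0, forall k, (k0 <= k)%N ->
    `|dev p r K (past (S ^~ w) (k ^ 4))| <= k%:R ^+ 3}.
Proof.
move=> p01 r01 K1 HGE.
have [C C0 HC] := dev_chebyshev p01 r01 K1 (law_ge0 S) (law_nil S)
  (law_split S) (law_step HGE).
pose large k v := (k.+1%:R ^+ 3 <= `|dev p r K v|).
pose F k := [set w | large k (past (S ^~ w) (k.+1 ^ 4))].
have mF k : measurable (F k) by exact: measurable_past.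
(* [1 / x ^ 2 <= 2 * (1 / x - 1 / (x + 1))] for [x >= 1] makes the Chebyshev bounds telescope. *)
have PF k : (P (F k) <= (2 * C * (k.+1%:R^-1 - k.+2%:R^-1))%:E)%E.
  apply: le_trans (prob_past_le S _ _) _; rewrite lee_fin.
  have k0 : 0 < k.+1%:R :> R by rewrite ltr0n.
  have e : (k.+1 ^ 4 = (k.+1 ^ 4).-1.+1)%N by rewrite prednK // expn_gt0.
  rewrite e; apply: le_trans (HC _ _ (exprn_gt0 3 k0)) _; rewrite -e natrX.
  have k1 : 1 <= k.+1%:R :> R by rewrite ler1n.
  rewrite -[k.+2%:R]natr1; move: k.+1%:R k0 k1 => x x0 x1.
  have -> : C * x ^+ 4 / (x ^+ 3) ^+ 2 = C * (x ^+ 2)^-1.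
    by field; rewrite lt0r_neq0.
  rewrite [2 * C]mulrC -mulrA ler_wpM2l //.
  have -> : 2 * (x^-1 - (x + 1)^-1) = 2 / (x * (x + 1)).
    by field; rewrite !lt0r_neq0 //; lra.
  rewrite -[leLHS]mul1r ler_pdivlMr ?mulr_gt0 //; last by lra.
  rewrite mul1r mulrC ler_pdivrMr ?exprn_gt0 //; nra.
have PF0 : P (lim_sup_set F) = 0%E.
  apply: lim_sup_set_cvg0 => //.
  apply: (@le_lt_trans _ _ (2 * C)%:E); last by rewrite ltry.
  apply: lime_le; first by apply: is_cvg_nneseries => *.
  apply: nearW => n.
  have sumF : (\sum_(0 <= k < n) P (F k) <= (2 * C * (1 - n.+1%:R^-1))%:E)%E.
    elim: n => [|n IH]; first by rewrite big_nil lee_fin invr1 subrr mulr0.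
    rewrite big_nat_recr //=; apply: le_trans (leeD IH (PF n)) _.
    by rewrite -EFinD lee_fin le_eqVlt; apply/orP; left; apply/eqP; ring.
  apply: le_trans sumF _; rewrite lee_fin -[leRHS]mulr1.
  by rewrite ler_wpM2l ?mulr_ge0 // gerBl invr_ge0.
exists (lim_sup_set F); split=> //.
  apply: bigcap_measurable => // n _; apply: bigcup_measurable => k _; exact: mF.
move=> w /= nw n _; apply: contrapT => h; apply: nw.
(* [F k] concerns the fourth power of [k.+1], hence the shifted threshold. *)
exists n.+1 => -[//|k] nk; rewrite leNgt; apply/negP => lt.
by apply: h; exists k => //=; rewrite /F /large /= ltW.
Qed.

Theorem lemma4 (R : realType) (d : measure_display) (T : measurableType d)
    (P : probability T R) (p r : R) (K : nat)
    (S : nat -> {RV P >-> bool}) (a0 : T -> nat -> R) :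
  0 < p < 1 -> 0 < r < 1 -> (1 <= K)%N ->
  GE_channel p r S ->
  {ae P, forall w : T,
    time_average (age K (fun t => S t w) (a0 w)) tau @[tau --> \oo]
      --> ((K%:R + 1) / 2 + p / (r * (p + r)) : R)}.
Proof.
move=> p01 r01 K1 HGE.
have [C HC] := sum_iage_dev p01 r01 K1.
apply: filterS (ae_dev_small p01 r01 K1 HGE) => w [k0 Hk0].
set c := fun t => S t w.
have r0 : 0 < r by case/andP: r01.
have mean_iage : arithmetic_mean (fun t => iage R K (past c t)) @ \oo
    --> limit_age p r K.
  (* The threshold [k0.+1] excludes [k = 0], as [HC] concerns nonempty sums; [C] is absorbed since
     [k ^ 3 >= 1]. *)
  apply: (@mean_cvg_of_fourth_powers _ _ _ (`|C| + r^-1) k0.+1).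
    by move=> t; exact: iage_ge0.
  move=> [//|k] /ltnW kk.
  have e : (k.+1 ^ 4 = (k.+1 ^ 4).-1.+1)%N by rewrite prednK // expn_gt0.
  have := HC c (k.+1 ^ 4).-1; rewrite -e => /le_trans; apply.
  have := Hk0 _ kk; rewrite -/c; move: (dev _ _ _ _) => x xk.
  have k1 : 1 <= k.+1%:R ^+ 3 :> R by rewrite exprn_ege1 // ler1n.
  rewrite mulrDl; apply: lerD.
    by apply: le_trans (ler_norm _) _; rewrite ler_peMr.
  by rewrite mulrC ler_wpM2l // invr_ge0 ltW.
(* Without any good slot the idealized age at index [n] would be at least [n], contradicting
   [mean_iage]; such trajectories thus already lie in the exceptional null set. *)
have [[k [k1 ck]]|nogood] := pselect (exists k, (1 <= k)%N /\ c k).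
  apply: time_average_cvg mean_iage => t kt.
  by apply: (@age_iage _ _ c _ _ k) => //; rewrite k1; exact: kt.
exfalso; apply: (arithmetic_mean_unbounded _ mean_iage) => n.
apply: iage_all_bad => // k /andP[k1 _]; apply/negP => ck.
by apply: nogood; exists k.
Qed.
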